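(* Let $K$ be a field, let $V_1,\ldots,V_\ell$ be finite-dimensional $K$-vector spaces, and let $s,t\in(V_1\otimes\cdots\otimes V_\ell)^*$ be tensors. The derivation-densor algorithm (described in the context) decides isomorphism of $s$ and $t$: on input $s,t$ it returns $\omega\in \mathrm{GL}(V_1)\times\cdots\times\mathrm{GL}(V_\ell)$ with $s^\omega=t$ if such an $\omega$ exists, and otherwise reports $s\not\cong t$.
   Context: A tensor is an element $t\in(V_1\otimes\cdots\otimes V_\ell)^*$ with $\ell\ge 2$, viewed as a multilinear form $\langle t|v_1,\ldots,v_\ell\rangle\in K$. For $\omega\in G:=\mathrm{GL}(V_1)\times\cdots\times\mathrm{GL}(V_\ell)$ let $\langle t^\omega|v_1,\ldots,v_\ell\rangle=\langle t|\omega_1v_1,\ldots,\omega_\ell v_\ell\rangle$. Tensors $s,t$ are isomorphic ($s\cong t$) if $s^\omega=t$ for some $\omega\in G$. The derivation algebra is $$\mathrm{Der}(t)=\Big\{\delta\in\bigoplus_{a=1}^{\ell}\mathfrak{gl}(V_a)\ \Big|\ \forall v_a\in V_a:\ \langle t|\delta_1v_1,v_2,\ldots,v_\ell\rangle+\cdots+\langle t|v_1,\ldots,v_{\ell-1},\delta_\ell v_\ell\rangle=0\Big\},$$ the densor space is $\mathrm{Dens}(t)=\{s\in(V_1\otimes\cdots\otimes V_\ell)^*\mid \mathrm{Der}(t)\subseteq\mathrm{Der}(s)\}$, and for $\mu\in G$, $\mathrm{Der}(s)^\mu=\{(\mu_1^{-1}\delta_1\mu_1,\ldots,\mu_\ell^{-1}\delta_\ell\mu_\ell)\mid\delta\in\mathrm{Der}(s)\}$.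 Put $$N(\mathrm{Der}(t))=\{\omega\in G\mid \forall\delta\in\mathrm{Der}(t),\ (\omega_1^{-1}\delta_1\omega_1,\ldots,\omega_\ell^{-1}\delta_\ell\omega_\ell)\in\mathrm{Der}(t)\}.$$ Derivation-densor algorithm, on input $s,t$: (1) Compute $\mathrm{Der}(s)$ and $\mathrm{Der}(t)$. (2) Test whether there exists $\mu\in G$ with $\mathrm{Der}(s)^\mu=\mathrm{Der}(t)$; if not, report $s\not\cong t$. (3) If so, fix such a $\mu$ and build the densor space $\mathrm{Dens}(t)$. (4) Compute the action of $N(\mathrm{Der}(t))$ on $\mathrm{Dens}(t)$. (5) Test whether there exists $\nu\in N(\mathrm{Der}(t))$ with $s^{\mu\nu}=t$; if so, return $\omega:=\mu\nu$; otherwise report $s\not\cong t$. The steps are taken as given subroutines (each existence test is assumed to be answered correctly, with a witness when one exists); the theorem is about correctness of the output, not running time. *)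

(* Defs.v *)
From HB Require Import structures.
From mathcomp Require Import all_boot all_order all_algebra.
From mathcomp Require Import boolp classical_sets.

Set Implicit Arguments.
Unset Strict Implicit.
Unset Printing Implicit Defensive.

Import GRing.Theory.

Local Open Scope ring_scope.
Local Open Scope classical_set_scope.

Section Tensors.
Variables (K : fieldType) (l : nat) (V : 'I_l -> vectType K).

Definition args := forall a : 'I_l, V a.

Definition multilinear (f : args -> K) : Prop :=
  forall (v : args) (a : 'I_l) (c : K) (x y : V a),
    f (dfwith v (c *: x + y)) = c * f (dfwith v x) + f (dfwith v y).

(* Elements of (V_1 (x) ... (x) V_l)^*, as multilinear forms. *)
Record tensor := Tensor {
  tensor_fun :> (forall a : 'I_l, V a) -> K;
  tensor_multilinear : multilinear tensor_fun
}.

(* The direct sum of the gl(V_a). *)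
Definition endos := forall a : 'I_l, 'End(V a).

(* The group G = GL(V_1) x ... x GL(V_l). *)
Record glprod := GLProd {
  gl_fun :> forall a : 'I_l, 'End(V a);
  gl_bij : forall a, bijective (gl_fun a)
}.

Lemma gl_mul_subproof (w u : glprod) (a : 'I_l) :
  bijective (w a \o u a)%VF.
Proof.
apply: (@eq_bij _ _ (w a \o u a)%FUN).
  by apply: bij_comp; apply: gl_bij.
by move=> x; rewrite lfunE.
Qed.

Definition gl_mul (w u : glprod) : glprod :=
  GLProd (gl_mul_subproof w u).

Definition gl_args (w : glprod) (v : args) : args := fun a => w a (v a).

Lemma gl_args_dfwith (w : glprod) (v : args) (a : 'I_l) (x : V a) :
  gl_args w (dfwith v x) = dfwith (gl_args w v) (w a x).
Proof.
apply: functional_extensionality_dep => b; rewrite /gl_args.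
by have [->|ab] := eqVneq b a; rewrite ?dfwith_in ?dfwith_out // eq_sym.
Qed.

Lemma tensor_act_subproof (t : tensor) (w : glprod) :
  multilinear (t \o gl_args w).
Proof.
by move=> v a c x y /=; rewrite !gl_args_dfwith linearP tensor_multilinear.
Qed.

(* t^w *)
Definition tensor_act (t : tensor) (w : glprod) : tensor :=
  Tensor (tensor_act_subproof t w).

Definition isomorphic (s t : tensor) : Prop :=
  exists w : glprod, tensor_act s w = t.

Definition Der (t : tensor) : set endos :=
  [set d : endos | forall v : args, \sum_(a < l) t (dfwith v (d a (v a))) = 0].

Definition Dens (t : tensor) : set tensor := [set s : tensor | Der t `<=` Der s].

(* _^-1%VF is in general only a partial inverse; it is the two-sided inverse
   here, since every component of w is bijective. *)
Definition conj_endos (w : glprod) (d : endos) : endos :=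
  fun a => ((w a)^-1 \o d a \o w a)%VF.

(* D^w *)
Definition conj_set (D : set endos) (w : glprod) : set endos :=
  [set conj_endos w d | d in D].

Definition normalizer (D : set endos) : set glprod :=
  [set w : glprod | forall d : endos, D d -> D (conj_endos w d)].

Definition acts_on (N : set glprod) (W : set tensor) : Prop :=
  forall w x, N w -> W x -> W (tensor_act x w).

(* Correctness of the answer r to the test "is there an element of P?". *)
Definition decides (T : Type) (P : set T) (r : option T) : Prop :=
  match r with
  | Some x => P x
  | None => ~ exists x, P x
  end.

Definition conjugacy_test := set endos -> set endos -> option glprod.

Definition conjugacy_test_correct (test : conjugacy_test) : Prop :=
  forall D E : set endos,
    decides [set mu : glprod | conj_set D mu = E] (test D E).

(* [test N W x y] searches for an element of N moving x to y, for the action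
   of N on W.  It is only trusted on meaningful inputs: N must act on W, and
   x and y must be in W. *)
Definition orbit_test :=
  set glprod -> set tensor -> tensor -> tensor -> option glprod.

Definition orbit_test_correct (test : orbit_test) : Prop :=
  forall (N : set glprod) (W : set tensor), acts_on N W ->
  forall x y : tensor, W x -> W y ->
    decides [set nu : glprod | N nu /\ tensor_act x nu = y] (test N W x y).

Inductive outcome :=
  | Isomorphism of glprod
  | NotIsomorphic.

Definition derivation_densor (conj_test : conjugacy_test)
    (orb_test : orbit_test) (s t : tensor) : outcome :=
  let Ds := Der s in
  let Dt := Der t in
  match conj_test Ds Dt with
  | None => NotIsomorphic
  | Some mu =>
      let W := Dens t in
      let N := normalizer Dt in
      match orb_test N W (tensor_act s mu) t with
      | None => NotIsomorphic
      | Some nu => Isomorphism (gl_mul mu nu)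
      end
  end.

End Tensors.

(* Main.v *)
Require Import Defs.
From HB Require Import structures.
From mathcomp Require Import all_boot all_order all_algebra.
From mathcomp Require Import boolp classical_sets.

(** The idea is that [t |-> Der t] is equivariant: [Der (t^w)] is the conjugate
    [(Der t)^w] ([Der_act]).  An isomorphism [w] from [s] to [t] therefore
    conjugates [Der s] to [Der t], so the conjugacy test cannot fail.  Whatever
    conjugator [mu] it returns, [s^mu] has the same derivation algebra as [t];
    hence [mu^-1 w], which carries [s^mu] to [t], normalizes [Der t], and no
    isomorphism is lost by restricting the second search to the normalizer.
    Conversely, an answer [mu nu] is an isomorphism because [G] acts on
    tensors on the right.

    The orbit test is only trusted on an action, so it must also be shown that
    the normalizer of [Der t] maps [Dens t] to itself ([normalizer_acts_Dens]).
    As the normalizer is defined by the inclusion [(Der t)^w <= Der t] alone,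
    this needs the opposite inclusion, and there finite dimension enters: an
    injective linear map sending a subspace of a finite-dimensional space into
    itself sends it onto itself ([injective_stable_surj]). *)

Set Implicit Arguments.
Unset Strict Implicit.
Unset Printing Implicit Defensive.

Import GRing.Theory VectorInternalTheory.

Section StableSubspace.
Local Open Scope ring_scope.
Local Open Scope classical_set_scope.

(** A subspace given by a proposition need not come as a [{vspace W}].  However,
    a vspace [U] of largest dimension inside [S] contains each [x] in [S],
    since [U + <[x]>] also lies inside [S]; comparing dimensions, [f] then maps
    [U] onto [U]. *)
Lemma injective_stable_surj (K : fieldType) (W : vectType K) (f : 'End(W))
    (S : set W) :
  lker f == 0%VS ->
  (forall c x y, S x -> S y -> S (c *: x + y)) ->
  (forall x, S x -> S (f x)) ->
  forall x, S x -> exists2 y, S y & f y = x.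
Proof.
move=> kerf Slin Sf x Sx.
have S0 : S 0 by rewrite -(addNr x) -scaleN1r; apply: Slin.
pose dims n := `[< exists2 U : {vspace W}, (forall y, y \in U -> S y)
                                           & \dim U = n >].
have dims_ex : exists n, dims n.
  exists 0%N; apply/asboolP; exists 0%VS; last exact: dimv0.
  by move=> y; rewrite memv0 => /eqP ->.
have dims_ub n : dims n -> (n <= \dim {:W})%N.
  by move/asboolP => [U _ <-]; apply: dimvS (subvf U).
case: (ex_maxnP dims_ex dims_ub) => n /asboolP [U US dimU] maxn.
have SU y : S y -> y \in U.
  move=> Sy.
  have /maxn : dims (\dim (<[y]> + U)).
    apply/asboolP; exists (<[y]> + U)%VS => // z.
    by case/memv_addP => _ /vlineP [c ->] [u /US Su ->]; apply: Slin.
  rewrite -dimU => dim_le.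
  have /eqP -> : (U == <[y]> + U)%VS by rewrite eqEdim addvSr.
  exact: (subvP (addvSl _ _)) (memv_line y).
have /eqP fU : (f @: U == U)%VS.
  rewrite eqEdim limg_dim_eq ?leqnn ?andbT; last first.
    by rewrite (eqP kerf) capv0.
  by apply/subvP => _ /memv_imgP [u /US Su ->]; apply/SU/Sf.
have := SU x Sx; rewrite -fU => /memv_imgP [y /US Sy ->].
by exists y.
Qed.

End StableSubspace.

Section Equivariance.
Local Open Scope ring_scope.
Local Open Scope classical_set_scope.
Variables (K : fieldType) (l : nat) (V : 'I_l -> vectType K).
Implicit Types (t x : tensor V) (w u : glprod V) (d e : endos V).

Lemma gl_ker w a : lker (w a) == 0%VS.
Proof. by apply/lker0P/bij_inj/gl_bij. Qed.

Lemma gl_inv_subproof w a : bijective (w a)^-1%VF.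
Proof.
exists (w a); first exact: lker0_lfunVK (gl_ker w a).
exact: lker0_lfunK (gl_ker w a).
Qed.

Definition gl_inv w : glprod V := GLProd (gl_inv_subproof w).

Lemma gl_argsVK w (v : args V) : gl_args w (gl_args (gl_inv w) v) = v.
Proof.
apply: functional_extensionality_dep => a.
exact: lker0_lfunVK (gl_ker w a) _.
Qed.

Lemma tensor_eq t x : (t : args V -> K) = x -> t = x.
Proof.
case: t x => [f fP] [g gP] /= fg; case: _ / fg gP => gP.
by rewrite (Prop_irrelevance fP gP).
Qed.

Lemma tensor_act_mul t w u :
  tensor_act t (gl_mul w u) = tensor_act (tensor_act t w) u.
Proof.
apply: tensor_eq; apply: funext => v /=; congr (t _).
by apply: functional_extensionality_dep => a; rewrite /gl_args /= lfunE.
Qed.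

Lemma tensor_actK t w : tensor_act (tensor_act t w) (gl_inv w) = t.
Proof. by apply: tensor_eq; apply: funext => v /=; rewrite gl_argsVK. Qed.

Lemma conj_endos_inj w : injective (conj_endos w).
Proof.
move=> d e de; apply: functional_extensionality_dep => a.
have := congr1 (fun c : endos V => (w a \o c a)%VF) de.
rewrite /conj_endos -!comp_lfunA !lker0_compVKf ?gl_ker // => dwew.
by rewrite -(lker0_compfK (gl_ker w a) (d a)) dwew lker0_compfK ?gl_ker.
Qed.

Lemma conj_endos_surj w e : exists d, conj_endos w d = e.
Proof.
exists (fun a => (w a \o e a \o (w a)^-1)%VF).
apply: functional_extensionality_dep => a; rewrite /conj_endos -!comp_lfunA.
by rewrite lker0_compKf ?gl_ker // lker0_compVf ?gl_ker // comp_lfun1r.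
Qed.

Lemma conj_endos_linear w c d e :
  conj_endos w (fun a => c *: d a + e a) =
  (fun a => c *: conj_endos w d a + conj_endos w e a).
Proof.
apply: functional_extensionality_dep => a; apply/lfunP => v.
by rewrite /conj_endos !lfunE /= !lfunE /= !lfunE /= !lfunE /= linearP.
Qed.

Lemma Der_linear t c d e : Der t d -> Der t e -> Der t (fun a => c *: d a + e a).
Proof.
move=> td te v.
under eq_bigr => a _ do rewrite !lfunE /= lfunE tensor_multilinear.
by rewrite big_split -mulr_sumr /= td te mulr0 addr0.
Qed.

(** Evaluating [conj_endos w d] on [t^w] at [v] gives the derivation identity
    of [d] on [t] at [gl_args w v], and every argument has that form. *)
Lemma Der_act_conj t w d : Der (tensor_act t w) (conj_endos w d) <-> Der t d.
Proof.
have eval v : \sum_(a < l) tensor_act t w (dfwith v (conj_endos w d a (v a))) =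
              \sum_(a < l) t (dfwith (gl_args w v) (d a (gl_args w v a))).
  apply: eq_bigr => a _; rewrite /= gl_args_dfwith; congr (t (dfwith _ _)).
  by rewrite /conj_endos !lfunE /= lfunE /= lker0_lfunVK ?gl_ker.
split=> td v; last by rewrite eval; apply: td.
by rewrite -(gl_argsVK w v) -eval; apply: td.
Qed.

Lemma Der_act t w : Der (tensor_act t w) = conj_set (Der t) w.
Proof.
apply/seteqP; split=> [e te|_ [d td <-]]; last exact/Der_act_conj.
by have [d de] := conj_endos_surj w e; exists d => //; apply/(Der_act_conj _ w);
  rewrite de.
Qed.

(** The components of [d] live in different spaces, so [endos V] is turned into
    a finite-dimensional space by concatenating their coordinates. *)
Definition endos_row d : 'rV[K]_(\sum_(a < l) dim 'End(V a)) :=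
  \mxrow_a v2r (d a).

Definition row_endos (r : 'rV[K]_(\sum_(a < l) dim 'End(V a))) : endos V :=
  fun a => r2v (submxrow r a).

Lemma endos_rowK : cancel endos_row row_endos.
Proof.
move=> d; apply: functional_extensionality_dep => a.
by rewrite /row_endos mxrowK v2rK.
Qed.

Lemma row_endosK : cancel row_endos endos_row.
Proof.
by move=> r; rewrite -[RHS]submxrowK; apply: eq_mxrow => a; rewrite r2vK.
Qed.

Lemma row_endos_linear c r r' :
  row_endos (c *: r + r') = (fun a => c *: row_endos r a + row_endos r' a).
Proof.
apply: functional_extensionality_dep => a; rewrite /row_endos -linearP.
by congr r2v; apply/matrixP => i j; rewrite !mxE.
Qed.

(** Conjugation by [w] is linear and injective, and [w] in the normalizer says
    that it sends [Der t] into itself; read in coordinates, this is an instance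
    of [injective_stable_surj]. *)
Lemma normalizer_Der_surj t w : normalizer (Der t) w ->
  forall e, Der t e -> exists2 d, Der t d & conj_endos w d = e.
Proof.
move=> Nw e te; pose f r := endos_row (conj_endos w (row_endos r)).
have f_lin : linear f.
  move=> c r r'; apply: (can_inj row_endosK).
  by rewrite row_endos_linear /f !endos_rowK row_endos_linear conj_endos_linear.
pose fL := GRing.isLinear.Build _ _ _ _ f f_lin.
pose fh : {linear _ -> _} := HB.pack f fL.
have fE r : linfun fh r = f r by rewrite lfunE.
pose S : set 'rV[K]_(\sum_(a < l) dim 'End(V a)) :=
  [set r | Der t (row_endos r)].
have [||||r Sr fr] := @injective_stable_surj _ _ (linfun fh) S _ _ _ (endos_row e).
- apply/lker0P => r r'; rewrite !fE => /(can_inj endos_rowK).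
  by move/conj_endos_inj/(can_inj row_endosK).
- by move=> c r r' Sr Sr'; rewrite /S /= row_endos_linear; apply: Der_linear.
- by move=> r /Nw; rewrite /S /= fE /f endos_rowK.
- by rewrite /S /= endos_rowK.
exists (row_endos r) => //; apply: (can_inj endos_rowK).
by rewrite -fr fE.
Qed.

(** Every [d] in [Der t] is [conj_endos w e] for some [e] in [Der t], hence in
    [Der x], and then [d] lies in [Der (x^w)]. *)
Lemma normalizer_acts_Dens t : acts_on (normalizer (Der t)) (Dens t).
Proof.
move=> w x Nw tx d td; have [e te <-] := normalizer_Der_surj Nw td.
by apply/Der_act_conj/tx.
Qed.

End Equivariance.

Theorem theorem2p3 (K : fieldType) (l : nat) (hl : 2 <= l)
    (V : 'I_l -> vectType K)
    (conj_test : conjugacy_test V) (orb_test : orbit_test V)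
    (conj_testP : conjugacy_test_correct conj_test)
    (orb_testP : orbit_test_correct orb_test)
    (s t : tensor V) :
  (isomorphic s t ->
     exists w : glprod V,
       derivation_densor conj_test orb_test s t = Isomorphism w /\
       tensor_act s w = t) /\
  (~ isomorphic s t ->
     derivation_densor conj_test orb_test s t = NotIsomorphic V).
Proof.
rewrite /derivation_densor; move: (conj_testP (Der s) (Der t)).
case: (conj_test (Der s) (Der t)) => [mu|] /= conj_st; last first.
  split=> // -[w sw]; case: conj_st; exists w.
  by rewrite -Der_act sw.
have Der_mu : Der (tensor_act s mu) = Der t by rewrite Der_act.
have Dens_mu : Dens t (tensor_act s mu) by rewrite /Dens /= Der_mu.
have Dens_t : Dens t t by move=> d.
move: (orb_testP _ _ (@normalizer_acts_Dens _ _ _ t) _ _ Dens_mu Dens_t).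
case: (orb_test _ _ _ _) => [nu|] /= orb_st.
  have iso : tensor_act s (gl_mul mu nu) = t by rewrite tensor_act_mul; case: orb_st.
  by split=> [_|[]]; [exists (gl_mul mu nu) | exists (gl_mul mu nu)].
split=> // -[w sw]; case: orb_st; exists (gl_mul (gl_inv mu) w).
have mu_w : tensor_act (tensor_act s mu) (gl_mul (gl_inv mu) w) = t.
  by rewrite tensor_act_mul tensor_actK.
split=> // d td.
by rewrite -[X in X (conj_endos _ _)]/(Der t) -mu_w; apply/Der_act_conj; rewrite Der_mu.
Qed.
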